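(* Let $n>1$. The structure $\circledast^{3}AG(n,3)$ is not embeddable into any affine space $AG(N,3)$. Consequently, $\widetilde{\circledast^{3}AG(n,3)}$ is not embeddable into any affine space $AG(N,3)$. Even more generally, for every $k\ge 1$, the structure obtained by $k$-fold applying the operation $\mathfrak M\longmapsto\widetilde{\circledast^{3}\mathfrak M}$ starting from $AG(n,3)$ is not embeddable into any affine space $AG(N,3)$. Its maximal affine subspaces are affine planes.
   Context: A partial Steiner triple system (PSTS) is a structure $\mathfrak M=\langle S,\mathcal L\rangle$ with point set $S$ and a family $\mathcal L$ of 3-element subsets of $S$ (lines) such that any two distinct points lie on at most one line; it is a Steiner triple system (STS) if any two distinct points lie on exactly one line. $AG(n,3)$, the $n$-dimensional affine space over $GF(3)$ with its points and lines, is an STS. $C_3$ is the group of integers modulo 3. $\circledast^{3}\mathfrak M$ is the PSTS with point set $S\times C_3$ whose lines are all the sets $\{(a,i),(b,i),(c,i+1)\}$ with $\{a,b,c\}\in\mathcal L$ (in any ordering of $a,b,c$) and $i\in C_3$. When $\mathfrak M$ is an STS, $\widetilde{\circledast^{3}\mathfrak M}$ is the STS with point set $S\times C_3$ whose lines are the lines of $\circledast^{3}\mathfrak M$ together with all the sets $\{a\}\times C_3$, $a\in S$. An embedding is an injective map of point sets that maps each line onto a line of the target affine space. A subspace of an STS is a set of points that contains the whole line through any two of its distinct points; it is affine if, with the lines contained in it, it is isomorphic to an affine space $AG(d,3)$. Maximal affine subspaces are the affine subspaces maximal with respect to inclusion; affine planes are those with $d=2$. *)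

(* Defs.v *)
From HB Require Import structures.
From mathcomp Require Import all_boot all_order all_algebra.

Set Implicit Arguments.
Unset Strict Implicit.
Unset Printing Implicit Defensive.

Import GRing.Theory.
Local Open Scope ring_scope.

Record psts := Psts {
  point : finType;
  lines : {set {set point}};
  line_card3 : forall L, L \in lines -> #|L| = 3%N;
  line_unique : forall (x y : point) (L L' : {set point}), x != y ->
    L \in lines -> x \in L -> y \in L ->
    L' \in lines -> x \in L' -> y \in L' -> L = L'
}.

(* Uniqueness of the joining line is already part of [psts]. *)
Record sts := Sts {
  psts_of_sts :> psts;
  line_exists : forall x y : point psts_of_sts, x != y ->
    exists L, [/\ L \in lines psts_of_sts, x \in L & y \in L]
}.

Section AffineSpace.
Variable n : nat.

Definition AG_lines : {set {set 'rV['F_3]_n}} :=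
  [set L | [exists p : 'rV['F_3]_n, exists v : 'rV['F_3]_n,
     (v != 0) && (L == [set p + t *: v | t : 'F_3])]].

Lemma AG_linesP (L : {set 'rV['F_3]_n}) :
  reflect (exists p v, v != 0 /\ L = [set p + t *: v | t : 'F_3])
          (L \in AG_lines).
Proof.
rewrite inE; apply: (iffP existsP) => [[p /existsP[v /andP[v0 /eqP->]]]|].
  by exists p, v.
by case=> p [v [v0 ->]]; exists p; apply/existsP; exists v; rewrite v0 eqxx.
Qed.

Lemma AG_line_card3 L : L \in AG_lines -> #|L| = 3%N.
Proof.
case/AG_linesP=> p [v [v0 ->]]; rewrite card_imset ?card_Fp // => s t.
move/addrI/eqP; rewrite -subr_eq0 -scalerBl scaler_eq0 (negPf v0) orbF.
by rewrite subr_eq0 => /eqP.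
Qed.

Lemma AG_line_join (x y : 'rV['F_3]_n) L : x != y -> L \in AG_lines ->
  x \in L -> y \in L -> L = [set x + t *: (y - x) | t : 'F_3].
Proof.
move=> xy /AG_linesP[p [v [v0 ->]]] /imsetP[s _ xE] /imsetP[r _ yE].
have yxE : y - x = (r - s) *: v.
  by rewrite xE yE opprD addrACA subrr add0r scalerBl.
have rs : r - s != 0.
  by apply: contraNneq xy => rs0; rewrite -subr_eq0 -opprB yxE rs0 scale0r oppr0.
apply/setP=> z; apply/imsetP/imsetP=> -[t _ ->].
  exists ((t - s) / (r - s)) => //.
  by rewrite yxE scalerA divfK // xE -addrA -scalerDl [s + _]addrC subrK.
exists (s + t * (r - s)) => //.
by rewrite yxE scalerA xE -addrA -scalerDl.
Qed.

Lemma AG_line_unique (x y : 'rV['F_3]_n) (L L' : {set 'rV['F_3]_n}) :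
  x != y -> L \in AG_lines -> x \in L -> y \in L ->
  L' \in AG_lines -> x \in L' -> y \in L' -> L = L'.
Proof.
move=> xy hL xL yL hL' xL' yL'.
by rewrite (AG_line_join xy hL xL yL) (AG_line_join xy hL' xL' yL').
Qed.

Definition AG_psts : psts := Psts AG_line_card3 AG_line_unique.

Lemma AG_line_exists (x y : point AG_psts) : x != y ->
  exists L, [/\ L \in lines AG_psts, x \in L & y \in L].
Proof.
move=> xy; exists [set x + t *: (y - x) | t : 'F_3]; split.
- by apply/AG_linesP; exists x, (y - x); rewrite subr_eq0 eq_sym.
- by apply/imsetP; exists 0; rewrite // scale0r addr0.
- by apply/imsetP; exists 1; rewrite // scale1r addrC subrK.
Qed.

Definition AG : sts := Sts AG_line_exists.

End AffineSpace.

Section Convolution.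
Variable M : psts.

Definition conv_lines : {set {set (point M * 'Z_3)}} :=
  [set L | [exists a, exists b, exists c, exists i : 'Z_3,
     ([set a; b; c] \in lines M) &&
     (L == [set (a, i); (b, i); (c, i + 1)])]].

Lemma conv_linesP (L : {set (point M * 'Z_3)}) :
  reflect (exists a b c (i : 'Z_3), [set a; b; c] \in lines M /\
             L = [set (a, i); (b, i); (c, i + 1)])
          (L \in conv_lines).
Proof.
rewrite inE; apply: (iffP existsP).
  by case=> a /existsP[b /existsP[c /existsP[i /andP[? /eqP->]]]]; exists a, b, c, i.
case=> a [b [c [i [h ->]]]]; exists a; apply/existsP; exists b.
by apply/existsP; exists c; apply/existsP; exists i; rewrite h eqxx.
Qed.

Lemma cards3P (T : finType) (a b c : T) :
  (#|[set a; b; c]| == 3%N) = [&& a != b, a != c & b != c].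
Proof.
rewrite setUC cardsU1 cards2 !inE (eq_sym c a) (eq_sym c b).
by case: (a == b); case: (a == c); case: (b == c).
Qed.

Lemma line_neq (N : psts) (a b c : point N) :
  [set a; b; c] \in lines N -> [&& a != b, a != c & b != c].
Proof. by move/line_card3=> h; rewrite -cards3P h. Qed.

Lemma conv_line_card3 L : L \in conv_lines -> #|L| = 3%N.
Proof.
case/conv_linesP=> a [b [c [i [/line_neq/and3P[ab ac bc] ->]]]].
by apply/eqP; rewrite cards3P !xpair_eqE (negPf ab) (negPf ac) (negPf bc).
Qed.

(* The levels of the points of a line of the convolution sum to 1. *)
Lemma conv_line_join (x y : point M) (i j : 'Z_3) L : (x, i) != (y, j) ->
  L \in conv_lines -> (x, i) \in L -> (y, j) \in L ->
  exists z, [set x; y; z] \in lines M /\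
            L = [set (x, i); (y, j); (z, 1 - i - j)].
Proof.
move=> xy /conv_linesP[a [b [c [k [h ->]]]]].
have e1 : 1 - k - k = k + 1 by apply/val_inj; case: k {h} => [[|[|[|]]]].
have e2 : 1 - k - (k + 1) = k by apply/val_inj; case: k {h e1} => [[|[|[|]]]].
have e3 : 1 - (k + 1) - k = k by rewrite addrAC.
have p1 (T : finType) (u v w : T) : [set u; v; w] = [set v; u; w].
  by rewrite (setUC [set u]).
have p2 (T : finType) (u v w : T) : [set u; v; w] = [set u; w; v].
  by rewrite setUAC.
move: xy; rewrite !inE -!orbA => xy /or3P[]/eqP[? ?] /or3P[]/eqP[? ?]; subst x y i j;
  rewrite ?eqxx // in xy *; rewrite ?e1 ?e2 ?e3.
- by exists c.
- by exists b; rewrite p2; split=> //; rewrite p2.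
- by exists c; rewrite p1; split=> //; rewrite p1.
- by exists a; split; [rewrite p2 p1 | rewrite [RHS]p2 [RHS]p1].
- by exists b; split; [rewrite p1 p2 | rewrite [RHS]p1 [RHS]p2].
- by exists a; split; [rewrite p1 p2 p1 | rewrite [RHS]p1 [RHS]p2 [RHS]p1].
Qed.

Lemma conv_line_unique (x y : point M * 'Z_3) (L L' : {set (point M * 'Z_3)}) :
  x != y -> L \in conv_lines -> x \in L -> y \in L ->
  L' \in conv_lines -> x \in L' -> y \in L' -> L = L'.
Proof.
case: x y => [x i] [y j] xy hL xL yL hL' xL' yL'.
have [z [hz ->]] := conv_line_join xy hL xL yL.
have [z' [hz' ->]] := conv_line_join xy hL' xL' yL'.
have /and3P[nxy nxz nyz] := line_neq hz.
have /setP/(_ z) : [set x; y; z] = [set x; y; z'].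
  by apply: (line_unique nxy); rewrite ?inE ?eqxx ?orbT.
by rewrite !inE eqxx orbT ![z == _]eq_sym (negPf nxz) (negPf nyz) => /esym/eqP->.
Qed.

Definition conv : psts := Psts conv_line_card3 conv_line_unique.

End Convolution.

Section ClosedConvolution.
Variable M : sts.

Definition fibre (a : point M) : {set (point M * 'Z_3)} :=
  [set (a, i) | i : 'Z_3].

Definition tconv_lines : {set {set (point M * 'Z_3)}} :=
  conv_lines M :|: [set fibre a | a : point M].

Lemma in_fibre a x : (x \in fibre a) = (x.1 == a).
Proof.
case: x => x i; apply/imsetP/eqP=> [[j _ [->]] //|/= ->].
by exists i.
Qed.

Lemma tconv_line_card3 L : L \in tconv_lines -> #|L| = 3%N.
Proof.
case/setUP=> [|/imsetP[a _ ->]]; first exact: conv_line_card3.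
by rewrite card_imset ?card_ord // => i j /(congr1 snd).
Qed.

Lemma conv_line_fst (x y : point M * 'Z_3) L : x != y -> L \in conv_lines M ->
  x \in L -> y \in L -> x.1 != y.1.
Proof.
case: x y => [x i] [y j] xy hL xL yL.
by have [z [/line_neq/and3P[]]] := conv_line_join xy hL xL yL.
Qed.

Lemma tconv_line_unique (x y : point M * 'Z_3) (L L' : {set (point M * 'Z_3)}) :
  x != y -> L \in tconv_lines -> x \in L -> y \in L ->
  L' \in tconv_lines -> x \in L' -> y \in L' -> L = L'.
Proof.
move=> xy /setUP[hL|/imsetP[a _ ->]] xL yL /setUP[hL'|/imsetP[a' _ ->]] xL' yL'.
- exact: (conv_line_unique xy).
- have := conv_line_fst xy hL xL yL.
  by move: xL' yL'; rewrite !in_fibre => /eqP-> /eqP->; rewrite eqxx.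
- have := conv_line_fst xy hL' xL' yL'.
  by move: xL yL; rewrite !in_fibre => /eqP-> /eqP->; rewrite eqxx.
- by move: xL xL'; rewrite !in_fibre => /eqP-> /eqP->.
Qed.

Definition tconv_psts : psts := Psts tconv_line_card3 tconv_line_unique.

Lemma line_third (x y : point M) : x != y -> exists z, [set x; y; z] \in lines M.
Proof.
move=> xy; have [L [hL xL yL]] := line_exists xy.
have sub : [set x; y] \subset L by rewrite subUset !sub1set xL.
have : #|L :\: [set x; y]| == 1%N.
  by rewrite cardsD (setIidPr sub) cards2 xy (line_card3 hL).
case/cards1P=> z Lz; exists z.
by rewrite -Lz setUC setDE setUIl [~: _ :|: _]setUC setUCr setIT (setUidPl sub).
Qed.

Lemma tconv_line_exists (x y : point tconv_psts) : x != y ->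
  exists L, [/\ L \in lines tconv_psts, x \in L & y \in L].
Proof.
case: x y => [x i] [y j] /= xy; have [exy|nxy] := eqVneq x y.
  exists (fibre x); rewrite !in_fibre exy !eqxx; split=> //.
  by apply/setUP; right; apply: imset_f.
have [z hz] := line_third nxy.
have hyxz : [set y; x; z] \in lines M by rewrite (setUC [set y]).
have hxzy : [set x; z; y] \in lines M by rewrite setUAC.
have hyzx : [set y; z; x] \in lines M by rewrite setUAC.
have : [|| j == i, j == i + 1 | i == j + 1].
  by case: i {xy} => [[|[|[|//]]] p]; case: j => [[|[|[|]]]].
case/or3P=> /eqP e.
- exists [set (x, i); (y, i); (z, i + 1)]; rewrite e; split; [|by rewrite !inE !eqxx ?orbT ..].
  by apply/setUP; left; apply/conv_linesP; exists x, y, z, i.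
- exists [set (x, i); (z, i); (y, i + 1)]; rewrite e; split; [|by rewrite !inE !eqxx ?orbT ..].
  by apply/setUP; left; apply/conv_linesP; exists x, z, y, i.
- exists [set (y, j); (z, j); (x, j + 1)]; rewrite e; split; [|by rewrite !inE !eqxx ?orbT ..].
  by apply/setUP; left; apply/conv_linesP; exists y, z, x, j.
Qed.

Definition tconv : sts := Sts tconv_line_exists.

End ClosedConvolution.

Definition embedding (M A : psts) (f : point M -> point A) : Prop :=
  injective f /\ forall L : {set point M}, L \in lines M -> f @: L \in lines A.

Definition embeddable (M A : psts) : Prop :=
  exists f : point M -> point A, embedding f.

Definition isomorphic (M M' : psts) : Prop :=
  exists f : point M -> point M',
    bijective f /\ forall L : {set point M},
      (f @: L \in lines M') = (L \in lines M).

Section Induced.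
Variables (M : psts) (X : {set point M}).

Definition induced_lines : {set {set {x | x \in X}}} :=
  [set L : {set {x | x \in X}} | val @: L \in lines M].

Lemma induced_line_card3 (L : {set {x | x \in X}}) : L \in induced_lines -> #|L| = 3%N.
Proof. by rewrite inE => /line_card3; rewrite card_imset //; apply: val_inj. Qed.

Lemma induced_line_unique (x y : {x | x \in X}) (L L' : {set {x | x \in X}}) :
  x != y -> L \in induced_lines -> x \in L -> y \in L ->
  L' \in induced_lines -> x \in L' -> y \in L' -> L = L'.
Proof.
rewrite !inE => xy hL xL yL hL' xL' yL'; apply: (imset_inj val_inj).
by apply: (@line_unique M (val x) (val y)); rewrite ?imset_f.
Qed.

Definition induced : psts := Psts induced_line_card3 induced_line_unique.

End Induced.

Section Subspaces.
Variable M : sts.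
Implicit Types X Y : {set point M}.

Definition subspace X : Prop :=
  forall (x y : point M) (L : {set point M}), x \in X -> y \in X -> x != y ->
    L \in lines M -> x \in L -> y \in L -> L \subset X.

Definition affine_subspace_dim (d : nat) X : Prop :=
  subspace X /\ isomorphic (induced X) (AG d).

Definition affine_subspace X : Prop := exists d, affine_subspace_dim d X.

Definition maximal_affine_subspace X : Prop :=
  affine_subspace X /\ forall Y, affine_subspace Y -> X \subset Y -> Y = X.

Definition affine_plane X : Prop := affine_subspace_dim 2 X.

End Subspaces.

(* Main.v *)
(* Write points of AG(N,3) so that a line is a triple of distinct vectors with sum 0.
   If f embeds the convolution of M, adding the relations of the lines over {a,b,c}
   shows that D = f(a,1) - f(a,0) does not depend on a in a plane of M and that
   f(a,0) + f(b,0) + f(c,0) = -D on its lines.  A function on an affine plane with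
   constant line sums s has s = 0, so D = 0 and f is not injective.  A line of M times
   C_3 is an affine plane, so the iterates contain planes as well.
   If an affine subspace of the closed convolution had dimension at least 3, the
   projection to M would identify points only along one direction, hence be injective
   on some affine plane; there the levels would sum to 1 on every line, against the
   same fact.  Affine subspaces of dimension at most 1 lie in a line of M times C_3. *)

Require Import Defs.
From HB Require Import structures.
From mathcomp Require Import all_boot all_order all_algebra.
From mathcomp Require Import ring.

Set Implicit Arguments.
Unset Strict Implicit.
Unset Printing Implicit Defensive.

Import GRing.Theory.
Local Open Scope ring_scope.

(** * Arithmetic over GF(3) and constant line sums *)

Lemma F3_third (V : lmodType 'F_3) (x : V) : - x - x = x.
Proof.
apply/eqP; rewrite -opprD eqr_oppLR -addr_eq0 -mulr2n -mulrSr -scaler_nat.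
by rewrite (_ : 3%:R = 0) ?scale0r //; apply: val_inj.
Qed.

Lemma F3P (t : 'F_3) : [\/ t = 0, t = 1 | t = -1].
Proof.
by case: t => [[|[|[|//]]] p];
  [constructor 1|constructor 2|constructor 3]; apply: val_inj.
Qed.

Lemma rV2_eq (T : Type) (x y : 'rV[T]_2) : x 0 0 = y 0 0 -> x 0 1 = y 0 1 -> x = y.
Proof.
move=> x0 x1; apply/rowP; case=> [[|[|//]] i2].
  by rewrite (_ : Ordinal i2 = 0) //; apply: val_inj.
by rewrite (_ : Ordinal i2 = 1) //; apply: val_inj.
Qed.

Lemma plane_sum_eq0 (g : 'rV['F_3]_2 -> 'F_3) (s : 'F_3) :
  (forall x y, x != y -> g x + g y + g (- x - y) = s) -> s = 0.
Proof.
move=> gs; pose p (a b : 'F_3) : 'rV['F_3]_2 := \row_i [:: a; b]`_i.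
have pE a b c d : - p a b - p c d = p (- a - c) (- b - d).
  by apply/rowP=> i; rewrite !mxE; case: i => [[|[|]]].
have line a b c d : ((a, b) != (c, d)) ->
    g (p a b) + g (p c d) + g (p (- a - c) (- b - d)) = s.
  move=> ne; rewrite -pE gs //; apply: contraNneq ne => /rowP h.
  by have := h 0; have := h 1; rewrite !mxE /= => -> ->.
have e1 : - 0 - 1 = -1 :> 'F_3 by apply: val_inj.
have e2 : - 1 - 1 = 1 :> 'F_3 by apply: val_inj.
have e3 : - (-1) - (-1) = -1 :> 'F_3 by apply: val_inj.
have e4 : - 0 - 0 = 0 :> 'F_3 by apply: val_inj.
have e5 : - 0 - (-1) = 1 :> 'F_3 by apply: val_inj.
have l1 := line 0 0 1 0 isT; have l2 := line 0 0 0 1 isT.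
have l3 := line 0 0 1 1 isT; have l4 := line 0 0 1 (-1) isT.
have r1 := line 0 1 1 1 isT; have r2 := line 0 (-1) 1 (-1) isT.
rewrite ?(e1, e2, e3, e4, e5) in l1 l2 l3 l4 r1 r2.
(* The four lines through the origin and three parallel lines covering the plane
   give [4 s - 3 s = 3 g(0)]. *)
have /= sum := congr2 (fun x y => x - y) (congr2 +%R (congr2 +%R l1 l2) (congr2 +%R l3 l4))
  (congr2 +%R (congr2 +%R l1 r1) r2).
have -> : s = 3%:R * g (p 0 0).
  transitivity (s + s + (s + s) - (s + s + s)); first by ring.
  by rewrite -sum; ring.
by rewrite (_ : 3%:R = 0) ?mul0r //; apply: val_inj.
Qed.

(** * Lines as triples and parametrised affine subspaces *)

Lemma set3P (T : finType) (A : {set T}) (x y z : T) : #|A| = 3%N ->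
  x != y -> x != z -> y != z -> x \in A -> y \in A -> z \in A ->
  A = [set x; y; z].
Proof.
move=> A3 xy xz yz xA yA zA; apply/esym/eqP; rewrite eqEcard A3.
have /eqP-> : #|[set x; y; z]| == 3%N by rewrite cards3P xy xz yz.
by rewrite !subUset !sub1set xA yA zA.
Qed.

(** The third point of the line through [x] and [y] in [AG d] is [- x - y], so this is an embedding
    of [AG d] written without sets of lines. *)
Definition affine_map (d : nat) (M : psts) (e : 'rV['F_3]_d -> point M) : Prop :=
  injective e /\ forall x y, x != y -> [set e x; e y; e (- x - y)] \in lines M.

Lemma AG_line_set3 d (x y : 'rV['F_3]_d) : x != y ->
  [set x; y; - x - y] \in AG_lines d.
Proof.
move=> xy; apply/AG_linesP; exists x, (y - x); split.
  by rewrite subr_eq0 eq_sym.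
have e2 : x + (-1) *: (y - x) = - x - y.
  by rewrite scaleN1r opprB addrA -{1}[x]F3_third addrNK.
apply/setP=> z; rewrite !inE -orbA; apply/or3P/imsetP.
  case=> /eqP->; [exists 0|exists 1|exists (-1)] => //.
  - by rewrite scale0r addr0.
  - by rewrite scale1r addrC subrK.
case=> t _ ->; case: (F3P t) => ->; rewrite ?e2 ?eqxx.
- by constructor 1; rewrite scale0r addr0.
- by constructor 2; rewrite scale1r addrC subrK.
- by constructor 3.
Qed.

Lemma neq_third d (x y : 'rV['F_3]_d) : x != y -> (x != - x - y) && (y != - x - y).
Proof.
by move/AG_line_set3/(@line_neq (AG d))/and3P=> [_ -> ->].
Qed.

Lemma AG_line_set3E d (x y : 'rV['F_3]_d) L : x != y -> L \in AG_lines d ->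
  x \in L -> y \in L -> L = [set x; y; - x - y].
Proof.
move=> xy hL xL yL; apply: (AG_line_unique xy) => //; first exact: AG_line_set3.
  by rewrite !inE eqxx.
by rewrite !inE eqxx orbT.
Qed.

(** Trades induced structures for parametrisations. The image of [e] is closed under lines because
    the line through [e x] and [e y] also consists of values of [e]. *)
Lemma affine_subspaceP (M : sts) d (X : {set point M}) :
  affine_subspace_dim d X <->
  exists e : 'rV['F_3]_d -> point M, affine_map e /\ X = [set e x | x : 'rV['F_3]_d].
Proof.
split.
  case=> _ [f [[g fK gK] fL]].
  exists (fun x => val (g x)); split; first split.
  - by move=> x y /val_inj/(can_inj gK).
  - move=> x y xy; have := fL (g @: [set x; y; - x - y]).
    rewrite -imset_comp (eq_imset (g := id)) ?imset_id; last exact: gK.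
    rewrite AG_line_set3 // => /esym; rewrite inE -imset_comp.
    by rewrite !imsetU !imset_set1.
  apply/setP=> a; apply/idP/imsetP => [aX|[x _ ->]]; last exact: valP.
  by exists (f (Sub a aX)); rewrite ?fK.
case=> e [[e_inj eL] ->]; split.
  move=> _ _ L /imsetP[x _ ->] /imsetP[y _ ->] exy hL xL yL.
  have xy : x != y by apply: contraNneq exy => ->.
  rewrite (line_unique exy hL xL yL (eL _ _ xy)) ?inE ?eqxx ?orbT //.
  by rewrite !subUset !sub1set !imset_f.
pose Y := [set e x | x : 'rV['F_3]_d]; have eX x : e x \in Y by rewrite imset_f.
pose g x : {a | a \in Y} := Sub (e x) (eX x).
have [f gK fK] : bijective g.
  apply: inj_card_bij => [x y /(congr1 val)/e_inj //|].
  by rewrite card_sig card_imset.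
exists f; split; first by exists g.
move=> L; have -> : (L \in lines (induced Y)) = (e @: (f @: L) \in lines M).
  rewrite -imset_comp -(eq_imset (f := val)) ?[LHS]inE // => a.
  by rewrite -{1}[a]fK.
move: (f @: L) => {}L; apply/idP/idP => hL.
  have /card_gt1P[x [y [xL yL xy]]] : (1 < #|L|)%N by rewrite (AG_line_card3 hL).
  by rewrite (AG_line_set3E xy hL xL yL) !imsetU !imset_set1 eL.
(* Lines are also reflected: two points of [L] span a line of [AG d] whose image shares two points
   with the line [e @: L], hence equals it. *)
have /card_gt1P[x [y [xL yL xy]]] : (1 < #|L|)%N.
  by rewrite -(card_imset _ e_inj) (line_card3 hL).
suff -> : L = [set x; y; - x - y] by apply: AG_line_set3.
apply: (imset_inj e_inj); rewrite !imsetU !imset_set1.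
apply: (@line_unique M (e x) (e y)); rewrite ?inj_eq ?imset_f ?eL //.
  by rewrite !inE eqxx.
by rewrite !inE eqxx orbT.
Qed.

(** * Non-embeddability of the convolution *)

Lemma conv_line (M : psts) (a b c : point M) (i j k : 'Z_3) :
  [set a; b; c] \in lines M -> i + j + k = 1 ->
  [set (a, i); (b, j); (c, k)] \in conv_lines M.
Proof.
have e1 (l : 'Z_3) : 1 - l - l = l + 1 by apply/val_inj; case: l => [[|[|[|]]]].
have e2 (l : 'Z_3) : 1 - l - (l + 1) = l by apply/val_inj; case: l => [[|[|[|]]]].
move=> abc ijk; have -> : k = 1 - i - j by rewrite -ijk; ring.
(* In each case the levels [i], [j], [1 - i - j] are a permutation of [l], [l], [l + 1], the pattern
   in the definition of the lines. *)
have e : [|| j == i, j == i + 1 | i == j + 1].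
  by case: i {ijk} => [[|[|[|//]]] p]; case: j => [[|[|[|]]]].
apply/conv_linesP; case/or3P: e => /eqP ->.
- by exists a, b, c, i; rewrite e1.
- by exists a, c, b, i; rewrite e2 setUAC; split=> //; rewrite setUAC.
have rot (T : finType) (u v w : T) : [set u; v; w] = [set v; w; u].
  by rewrite -setUA setUC.
by exists b, c, a, j; rewrite addrAC e2 -!(rot _ _ b c).
Qed.

(** The argument takes place over a single affine plane of [M], so it serves [AG n] and the iterates
    alike. *)
Lemma conv_not_embeddable (M : psts) (e : 'rV['F_3]_2 -> point M) N :
  affine_map e -> ~ embeddable (conv M) (AG N).
Proof.
case=> e_inj eL [f [f_inj fL]].
have sum0 a b c (i j k : 'Z_3) : [set a; b; c] \in lines M -> i + j + k = 1 ->
    f (a, i) + f (b, j) + f (c, k) = 0.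
  move=> abc ijk; have /and3P[ab _ _] := line_neq abc.
  have := fL _ (conv_line abc ijk); rewrite !imsetU !imset_set1.
  have fab : f (a, i) != f (b, j) by rewrite (inj_eq f_inj) xpair_eqE (negPf ab).
  move=> hL; move: (hL) => /(AG_line_set3E fab).
  rewrite !inE !eqxx orbT => /(_ isT isT) /setP/(_ (f (c, k))).
  have /and3P[_ ac bc] := line_neq hL.
  rewrite !inE eqxx orbT ![f (c, k) == _]eq_sym (negPf ac) (negPf bc) /=.
  by move/esym/eqP <-; rewrite -opprD subrr.
pose D x := f (e x, 1) - f (e x, 0).
(* Over one line, the levels 1, 0, 0 and 0, 1, 0 both give sum 0; their difference is
   [D x - D y]. *)
have DE x y : x != y -> D x = D y.
  move=> /eL h; apply: (addIr (f (e y, 0) + f (e x, 0) + f (e (- x - y), 0))).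
  transitivity (f (e x, 1) + f (e y, 0) + f (e (- x - y), 0)).
    by rewrite [f (e y, 0) + _]addrC !addrA subrK.
  rewrite !addrA subrK [f (e y, 1) + _]addrC.
  by rewrite (sum0 _ _ _ 1 0 0) ?addr0 // (sum0 _ _ _ 0 1 0) ?addr0 ?add0r.
have gs x y : x != y ->
    f (e x, 0) + f (e y, 0) + f (e (- x - y), 0) = - D 0.
  (* Moving [D] to the third point reduces the claim to the relation with levels 0, 0, 1. *)
  move=> xy; have -> : D 0 = D (- x - y).
    by have [<-//|/DE] := eqVneq 0 (- x - y).
  apply: (addIr (D (- x - y))); rewrite addNr addrA [_ + f (_, 1)]addrAC addrK.
  by rewrite (sum0 _ _ _ 0 0 1 (eL _ _ xy)) ?add0r.
have D0 : - D 0 = 0.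
  apply/rowP=> i; rewrite [RHS]mxE.
  apply: (plane_sum_eq0 (g := fun x => f (e x, 0) 0 i)) => x y xy.
  by rewrite -(gs x y xy) !mxE.
by have /eqP := D0; rewrite oppr_eq0 subr_eq0 (inj_eq f_inj) xpair_eqE andbF.
Qed.

Lemma tconv_not_embeddable (M : sts) (e : 'rV['F_3]_2 -> point M) N :
  affine_map e -> ~ embeddable (tconv M) (AG N).
Proof.
move=> he [f [f_inj fL]]; apply: (@conv_not_embeddable M e N he).
by exists f; split=> // L hL; apply: fL; apply/setUP; left.
Qed.

(** Rows of length 2 are padded with zeros; truncation is a left inverse because [n] is at least
    2. *)
Lemma AG_plane n : (1 < n)%N -> exists e : 'rV['F_3]_2 -> point (AG n), affine_map e.
Proof.
move=> hn; pose e (x : 'rV['F_3]_2) : 'rV['F_3]_n := x *m pid_mx 2.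
have e_inj : injective e.
  apply: (can_inj (g := fun y => y *m pid_mx 2)) => x.
  by rewrite -mulmxA mul_pid_mx minnn (minn_idPr hn) pid_mx_1 mulmx1.
exists e; split=> // x y xy; rewrite /e mulmxBl mulNmx.
by apply: AG_line_set3; rewrite (inj_eq e_inj).
Qed.

(** * Dimension of affine subspaces of the closed convolution *)

Lemma third_unique (M : psts) (a b c c' : point M) :
  [set a; b; c] \in lines M -> [set a; b; c'] \in lines M -> c = c'.
Proof.
move=> h h'; have /and3P[ab ac bc] := line_neq h.
have /setP/(_ c) : [set a; b; c] = [set a; b; c'].
  by apply: (line_unique ab); rewrite ?inE ?eqxx ?orbT.
by rewrite !inE eqxx orbT ![c == _]eq_sym (negPf ac) (negPf bc) => /esym/eqP->.
Qed.

Lemma tconv_line_cases (M : sts) (x y z : point M * 'Z_3) :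
  [set x; y; z] \in tconv_lines M ->
  (x.1 = y.1 /\ z.1 = y.1) \/
  ([set x.1; y.1; z.1] \in lines M /\ x.2 + y.2 + z.2 = 1).
Proof.
case: x y z => [a i] [b j] [c k] h.
have /and3P[xy xz yz] := @line_neq (tconv M) _ _ _ h.
case/setUP: h => [h|/imsetP[d _ h]].
  right; have [||c' [abc' E]] := conv_line_join xy h; rewrite ?inE ?eqxx ?orbT //.
  have /setP/(_ (c, k)) := E; rewrite !inE eqxx orbT !(eq_sym (c, k)).
  rewrite (negPf xz) (negPf yz) /= => /esym/eqP[<- <-]; split=> //=.
  by ring.
left; have /setP h' := h.
by move: (h' (a, i)) (h' (b, j)) (h' (c, k)); rewrite !in_fibre !inE !eqxx ?orbT;
  do 3!move/esym/eqP=> /= ->.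
Qed.

(** By counting: [u] avoids the at most 3 multiples of [k], then [w] avoids the at most 9
    combinations of [u] and [k], and both numbers are below [3 ^ d]. The span of [u] and [w] then
    meets that of [k] only in 0. *)
Lemma exists_complement d (k : 'rV['F_3]_d) : (2 < d)%N ->
  exists u w, forall a b t : 'F_3, a *: u + b *: w = t *: k -> a = 0 /\ b = 0.
Proof.
move=> d2.
have missed (A : finType) (h : A -> 'rV['F_3]_d) : (#|A| < 3 ^ d)%N ->
    exists x, forall a, x != h a.
  move=> hA; have [x xA|all] := pickP [pred x | x \notin codom h].
    by exists x => a; apply: contraNneq xA => ->; apply: codom_f.
  move: hA; rewrite ltnNge; case/negP.
  have <- : #|'rV['F_3]_d| = (3 ^ d)%N by rewrite card_mx card_Fp // mul1n.
  rewrite -(size_codom h); apply: leq_trans (card_size _).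
  by apply/subset_leq_card/subsetP => x _; have /negbFE := all x.
have [u uP] : exists u, forall t : 'F_3, u != t *: k.
  by apply: missed; rewrite card_Fp // -{1}[3%N]expn1 ltn_exp2l // ltnW.
have [w wP] : exists w, forall st : 'F_3 * 'F_3, w != st.1 *: u + st.2 *: k.
  by apply: missed; rewrite card_prod card_Fp // mulnn ltn_exp2l.
exists u, w => a b t h.
have b0 : b = 0.
  apply: contraTeq isT => b0; have := wP (- a / b, t / b).
  rewrite ![_ / b]mulrC -!scalerA -scalerDr scaleNr -h addKr scalerA mulVf //.
  by rewrite scale1r eqxx.
split=> //; move: h; rewrite b0 scale0r addr0 => h.
apply: contraTeq isT => a0; have := uP (t / a).
by rewrite mulrC -scalerA -h scalerA mulVf // scale1r eqxx.
Qed.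

Lemma tconv_affine_dim (M : sts) d (e : 'rV['F_3]_d -> point (tconv M)) :
  affine_map e -> (d <= 2)%N.
Proof.
case=> e_inj eL; rewrite leqNgt; apply/negP => d2.
(* [T] is collinearity in [M] with constant triples allowed, the relation that survives projection;
   its third entry is determined by the first two. *)
pose p x := (e x).1; pose T a b c := (a = b /\ c = b) \/ [set a; b; c] \in lines M.
have eT x y : T (p x) (p y) (p (- x - y)).
  have [->|/eL/tconv_line_cases] := eqVneq x y; first by left; rewrite F3_third.
  by case=> [h|[h _]]; [left|right].
have T_fun a b c c' : T a b c -> T a b c' -> c = c'.
  case=> [[-> ->]|h] [[// eab ->]|h'] //; last exact: third_unique h h'.
    by have := line_neq h'; rewrite eqxx.
  by have := line_neq h; rewrite eab eqxx.
(* The triples [- x, y, x - y] and [- x, x, 0] project to [T]-triples that agree in the first two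
   entries. *)
have p_sub x y : p x = p y -> p (x - y) = p 0.
  move=> pxy; have := eT (- x) y; rewrite -pxy opprK => h.
  by apply: T_fun h _; have := eT (- x) x; rewrite opprK subrr.
(* [k] spans the direction along which the projection [p] is not injective, if any. *)
have [k kP] : exists k, forall v, p v = p 0 -> exists t : 'F_3, v = t *: k.
  have [k /= /andP[k0 /eqP pk]|none] := pickP [pred v | (v != 0) && (p v == p 0)].
    exists k => v pv.
    have fib : fibre (p 0) = [set e 0; e k; e (- 0 - k)].
      apply: (@line_unique (tconv M) (e 0) (e k)).
      - by rewrite (inj_eq e_inj) eq_sym.
      - by apply/setUP; right; apply: imset_f.
      - by rewrite in_fibre.
      - by rewrite in_fibre -pk.
      - by apply: eL; rewrite eq_sym.
      - by rewrite !inE eqxx.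
      - by rewrite !inE eqxx orbT.
    have : e v \in fibre (p 0) by rewrite in_fibre -pv.
    rewrite fib !inE !(inj_eq e_inj) oppr0 add0r -orbA => /or3P[]/eqP->.
    - by exists 0; rewrite scale0r.
    - by exists 1; rewrite scale1r.
    - by exists (-1); rewrite scaleN1r.
  exists 0 => v pv; exists 0; rewrite scaler0.
  by have /negbT := none v; rewrite /= pv eqxx andbT negbK => /eqP.
have [u [w uwP]] := exists_complement k d2.
pose q (z : 'rV['F_3]_2) := z 0 0 *: u + z 0 1 *: w.
have qB x y : q (x - y) = q x - q y.
  by rewrite /q !mxE !scalerBl opprD addrACA.
have pq_inj x y : p (q x) = p (q y) -> x = y.
  move/p_sub; rewrite -qB => /kP[t /uwP[h0 h1]].
  by apply/eqP; rewrite -subr_eq0; apply/eqP/rV2_eq; rewrite ?h0 ?h1 mxE.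
(* On the plane parametrised by [q] no line projects to a point, so the levels, read in ['F_3], sum
   to 1 on every line. *)
suff /eqP : 1 = 0 :> 'F_3 by [].
apply: (@plane_sum_eq0 (fun z => (e (q z)).2)) => x y xy; have qxy : q x != q y.
  by apply: contraNneq xy => /(congr1 p)/pq_inj->.
have -> : q (- x - y) = - q x - q y.
  by rewrite qB -[- x]add0r qB -[in RHS](sub0r (q x)) /q !mxE !scale0r addr0.
case: (tconv_line_cases (eL _ _ qxy)) => [[/pq_inj exy _]|[_ //]].
by rewrite exy eqxx in xy.
Qed.

(** * Planes over lines, maximality and iteration *)

Lemma tconv_plane (M : sts) (a b c : point M) : [set a; b; c] \in lines M ->
  @affine_plane (tconv M) [set x | x.1 \in [set a; b; c]].
Proof.
move=> abc; apply/affine_subspaceP.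
pose P (t : 'F_3) := if t == 0 then a else if t == 1 then b else c.
(* The shift [s] has sum 1 on the base line, which turns the level condition
   [i + j + k = 1] into [i + j + k = 0]. *)
pose s (t : 'F_3) : 'Z_3 := if t == -1 then 1 else 0.
have [P0 P1 PN] : [/\ P 0 = a, P 1 = b & P (-1) = c] by [].
have [s0 s1 sN] : [/\ s 0 = 0, s 1 = 0 & s (-1) = 1] by [].
have third0 := (@oppr0 'F_3, @opprK 'F_3, @sub0r 'F_3, @subr0 'F_3, @addNr 'F_3, @subrr 'F_3).
have rot (u v w : point M) : [set u; v; w] = [set v; w; u] by rewrite -setUA setUC.
have flip (u v w : point M) : [set u; v; w] = [set u; w; v] by rewrite setUAC.
have PL t t' : t != t' -> [set P t; P t'; P (- t - t')] \in lines M.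
  case: (F3P t) => ->; case: (F3P t') => -> // _; rewrite ?third0 ?P0 ?P1 ?PN //.
  - by rewrite flip.
  - by rewrite rot flip.
  - by rewrite -rot.
  - by rewrite rot.
  - by rewrite -rot flip.
have sum_s t t' : t != t' -> s t + s t' + s (- t - t') = 1.
  case: (F3P t) => ->; case: (F3P t') => -> // _; rewrite ?third0 ?s0 ?s1 ?sN //;
  by rewrite ?addr0 ?add0r.
have P_inj : injective P.
  move=> t t' Ptt; apply: contra_eq Ptt => /PL/line_neq.
  by case/and3P.
(* The first coordinate selects a point of the base line, the second moves along its fibre. Lines
   with constant first coordinate become fibres, all others lines of the convolution. *)
pose e (z : 'rV['F_3]_2) : point (tconv M) := (P (z 0 0), s (z 0 0) + z 0 1).
have e_inj : injective e.
  move=> x y exy; have /= /P_inj x0 := congr1 fst exy.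
  have /= := congr1 snd exy; rewrite x0 => /addrI x1.
  exact: rV2_eq.
exists e; split; first split=> // x y xy.
  have /andP[xz yz] := neq_third xy; have [xy0|nxy0] := eqVneq (x 0 0) (y 0 0).
    have z0 : (- x - y) 0 0 = x 0 0.
      by rewrite !mxE -xy0; case: (F3P (x 0 0)) => ->; apply: val_inj.
    apply/setUP; right; apply/imsetP; exists (P (x 0 0)) => //; apply/esym.
    apply: set3P; rewrite ?(inj_eq e_inj) //.
    - by apply: (@tconv_line_card3 M); apply/setUP; right; apply: imset_f.
    - by rewrite in_fibre.
    - by rewrite in_fibre xy0.
    - by rewrite in_fibre /e z0.
  apply/setUP; left; apply: conv_line; rewrite !mxE ?PL //.
  by rewrite -(sum_s _ _ nxy0); ring.
apply/setP=> -[x i]; rewrite inE /=; apply/idP/imsetP => [xL|[z _ [-> _]]].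
  have [t ->] : exists t, x = P t.
    by move: xL; rewrite !inE -orbA => /or3P[]/eqP->; [exists 0|exists 1|exists (-1)].
  exists (\row_k [:: t; i - s t]`_k) => //.
  by rewrite /e !mxE /= [_ + (i - _)]addrC subrK.
by rewrite /P !inE; case: ifP => _; [|case: ifP => _]; rewrite eqxx ?orbT.
Qed.

Lemma row_collinear d (x y : 'rV['F_3]_d) : (d < 2)%N -> 0 != y ->
  exists t : 'F_3, x = t *: y.
Proof.
case: d x y => [|[|//]] x y _ y0; first by exists 0; rewrite [LHS]thinmx0 [RHS]thinmx0.
exists (x 0 0 / y 0 0); apply/rowP=> i; rewrite mxE ord1 divfK //.
by apply: contraNneq y0 => y0; apply/eqP/rowP=> j; rewrite ord1 y0 mxE.
Qed.

Lemma maximal_affine_subspace_tconv (M : sts) (X : {set point (tconv M)}) :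
  (1 < #|point M|)%N -> maximal_affine_subspace X -> affine_plane X.
Proof.
move=> M1 [[d Xd] Xmax]; have [e [he XE]] := (affine_subspaceP _ _).1 Xd.
have := tconv_affine_dim he; rewrite leq_eqVlt => /predU1P[d2|d1].
  by rewrite /affine_plane -d2.
(* In dimension at most 1 the projection lies in a line of [M]. If it is a single point, a second
   point of [M] provides a line through it. *)
have [a [b [c [abc sub]]]] : exists a b c, [set a; b; c] \in lines M /\
    forall x, (e x).1 \in [set a; b; c].
  have [y /= y0|all] := pickP [pred y | (e 0).1 != (e y).1].
    have yn0 : 0 != y by apply: contraNneq y0 => <-.
    exists (e 0).1, (e y).1, (e (- 0 - y)).1; split.
      case: (tconv_line_cases (he.2 _ _ yn0)) => [[E _]|[] //].
      by rewrite E eqxx in y0.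
    move=> x; have [t ->] : exists t : 'F_3, x = t *: y.
      exact: row_collinear.
    case: (F3P t) => ->; rewrite ?scale0r ?scale1r ?scaleN1r ?sub0r ?oppr0 ?add0r.
    - by rewrite !inE eqxx.
    - by rewrite !inE eqxx orbT.
    - by rewrite !inE eqxx orbT.
  have all0 x : (e x).1 = (e 0).1 by have /negbFE/eqP := all x.
  have /card_gt1P[x [y [_ _ xy]]] := M1.
  have [b ab] : exists b, (e 0).1 != b.
    by have [E|] := eqVneq (e 0).1 x; [exists y; rewrite E|exists x].
  have [c abc] := line_third ab.
  by exists (e 0).1, b, c; split=> // z; rewrite all0 !inE eqxx.
have Yp := tconv_plane abc; rewrite -(Xmax _ (ex_intro _ 2 Yp)) //.
by rewrite XE; apply/subsetP => _ /imsetP[x _ ->]; rewrite inE sub.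
Qed.

Theorem proposition4p12 (n : nat) (hn : (1 < n)%N) :
  (forall N : nat, ~ embeddable (conv (AG n)) (AG N)) /\
  (forall N : nat, ~ embeddable (tconv (AG n)) (AG N)) /\
  (forall k : nat, (1 <= k)%N ->
     (forall N : nat, ~ embeddable (iter k tconv (AG n)) (AG N)) /\
     (forall X : {set point (iter k tconv (AG n))},
        maximal_affine_subspace X -> affine_plane X)).
Proof.
have [e he] := AG_plane hn.
split=> [N|]; first exact: conv_not_embeddable he.
split=> [N|[//|k] _]; first exact: tconv_not_embeddable he.
have card1 j : (1 < #|point (iter j tconv (AG n))|)%N.
  elim: j => [|j IHj] /=.
    by rewrite card_mx card_Fp // mul1n -(expn0 3) ltn_exp2l // ltnW.
  by rewrite card_prod card_ord (leq_trans IHj) // leq_pmulr.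
split=> [N|X]; last exact: (maximal_affine_subspace_tconv (card1 k)).
(* With [k.+1] in place of the exponent, the structure is [tconv] of the [k]-th iterate. That
   iterate contains a plane: the given one in [AG n], or one over a line of the preceding
   iterate. *)
suff [e' he'] : exists e' : 'rV['F_3]_2 -> point (iter k tconv (AG n)), affine_map e'.
  exact: tconv_not_embeddable he'.
case: k => [|k]; first by exists e.
have /card_gt1P[x [y [_ _ xy]]] := card1 k.
have [z xyz] := line_third xy.
by have [e' [he' _]] := (affine_subspaceP _ _).1 (tconv_plane xyz); exists e'.
Qed.
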